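(* Let $G$ and $H$ be finite, simple graphs and let $\ell$ be a leaf of $G$ such that $\gamma(G-\ell)=\gamma(G)-1$. If $\gamma(G\square H)\ge\gamma(G)\gamma(H)$, then $\gamma((G-\ell)\square H)\ge\gamma(G-\ell)\gamma(H)$.
   Context: $\gamma(G)$ is the domination number of $G$, i.e. the minimum cardinality of a dominating set of $G$ (a set $D\subseteq V(G)$ such that every vertex is in $D$ or adjacent to a vertex of $D$). $G\square H$ is the Cartesian product of the graphs $G$ and $H$. A leaf is a vertex with exactly one neighbour, and $G-\ell$ is the graph obtained from $G$ by deleting the vertex $\ell$. *)

(* Defs.v *)
From mathcomp Require Import all_boot.

Set Implicit Arguments.
Unset Strict Implicit.
Unset Printing Implicit Defensive.

(* The graph with no vertex is allowed; its domination number is 0. *)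
Record sgraph := SGraph {
  vertex :> finType;
  adj : rel vertex;
  adj_sym : symmetric adj;
  adj_irr : irreflexive adj
}.

Definition neighbours (G : sgraph) (v : G) : {set G} := [set w | adj v w].

Definition leaf (G : sgraph) (v : G) : bool := #|neighbours v| == 1.

Definition dominating (G : sgraph) (D : {set G}) : bool :=
  [forall v, (v \in D) || [exists w in D, adj v w]].

Lemma dominating_setT (G : sgraph) : dominating [set: G].
Proof. by apply/forallP => v; rewrite inE. Qed.

(* By [dominating_setT] the starting point of the minimization is itself
   dominating, so this is the minimum over all dominating sets. *)
Definition gamma (G : sgraph) : nat :=
  #|[arg min_(D < [set: G] | dominating D) #|D|]|.

Section DeleteVertex.
Variables (G : sgraph) (l : G).

Definition del_adj : rel {v : G | v != l} := fun x y => adj (val x) (val y).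

Lemma del_adj_sym : symmetric del_adj.
Proof. by move=> x y; rewrite /del_adj adj_sym. Qed.

Lemma del_adj_irr : irreflexive del_adj.
Proof. by move=> x; rewrite /del_adj adj_irr. Qed.

Definition del_vertex : sgraph := SGraph del_adj_sym del_adj_irr.

End DeleteVertex.

Section CartesianProduct.
Variables G H : sgraph.

Definition box_adj : rel (G * H) := fun x y =>
  (x.1 == y.1) && adj x.2 y.2 || (x.2 == y.2) && adj x.1 y.1.

Lemma box_adj_sym : symmetric box_adj.
Proof.
by move=> x y; rewrite /box_adj ![y.1 == _]eq_sym ![y.2 == _]eq_sym
  (adj_sym x.1) (adj_sym x.2).
Qed.

Lemma box_adj_irr : irreflexive box_adj.
Proof. by move=> x; rewrite /box_adj !adj_irr !andbF. Qed.

Definition cart_prod : sgraph := SGraph box_adj_sym box_adj_irr.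

End CartesianProduct.

(* Main.v *)
Require Import Defs.
From mathcomp Require Import all_boot.

(** Deleting a vertex [l] of [G] lowers the domination number of the product
    with [H] by at most [gamma H]: a dominating set of the product of [G - l]
    with [H] dominates every fibre of [H] except the one over [l], and that
    fibre is a copy of [H], which a minimum dominating set of [H], placed over
    [l], dominates.  This is [gamma_box_del].  When moreover
    [gamma (G - l) = gamma G - 1], the deletion lowers [gamma G * gamma H] by
    [gamma H], so the inequality passes from [G] to [G - l]. *)

Lemma gamma_le (G : sgraph) (D : {set G}) : dominating D -> gamma G <= #|D|.
Proof.
rewrite /gamma => domD.
by case: arg_minnP => [|M _]; [exact: dominating_setT | apply].
Qed.

Lemma gamma_attained (G : sgraph) :
  exists2 D : {set G}, dominating D & #|D| = gamma G.
Proof.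
rewrite /gamma; case: arg_minnP => [|M domM _]; first exact: dominating_setT.
by exists M.
Qed.

Lemma gamma_box_del (G H : sgraph) (l : G) :
  gamma (cart_prod G H) <= gamma (cart_prod (del_vertex l) H) + gamma H.
Proof.
have [D /forallP domD <-] := gamma_attained (cart_prod (del_vertex l) H).
have [E /forallP domE <-] := gamma_attained H.
pose incl (p : cart_prod (del_vertex l) H) : cart_prod G H := (val p.1, p.2).
pose fibre (h : H) : cart_prod G H := (l, h).
apply: (@leq_trans #|(incl @: D) :|: (fibre @: E)|); last first.
  by rewrite (leq_trans (leq_card_setU _ _)) // leq_add ?leq_imset_card.
apply/gamma_le/forallP => -[g h].
have [->|g_neq_l] := eqVneq g l.
  have /orP[hE|/exists_inP[w wE hw]] := domE h.
    by apply/orP; left; rewrite inE (imset_f fibre hE) orbT.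
  apply/orP; right; apply/exists_inP; exists (fibre w).
    by rewrite inE (imset_f fibre wE) orbT.
  by rewrite /= /box_adj /= eqxx hw.
pose g' : del_vertex l := Sub g g_neq_l.
have /orP[gD|/exists_inP[w wD gw]] := domD (g', h).
  by apply/orP; left; rewrite inE (imset_f incl gD).
apply/orP; right; apply/exists_inP; exists (incl w).
  by rewrite inE (imset_f incl wD).
(* [box_adj] over [G - l] is the restriction of [box_adj] over [G], since [val]
   reflects equality and [del_adj] is defined through it. *)
exact: gw.
Qed.

Theorem mainTheorem6 (G H : sgraph) (l : G)
  (hleaf : leaf l)
  (hgamma : gamma (del_vertex l) = gamma G - 1)
  (hG : gamma (cart_prod G H) >= gamma G * gamma H) :
  gamma (cart_prod (del_vertex l) H) >= gamma (del_vertex l) * gamma H.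
Proof.
rewrite hgamma mulnBl mul1n leq_subLR addnC.
exact: leq_trans hG (gamma_box_del _ H l).
Qed.
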